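(* Let $K$ be a field with $\mathrm{char}(K)\neq 2$ and let $E$ be an elliptic curve over $K$. Then $E(K)$ contains a subgroup isomorphic to $\mathbb{Z}/4\mathbb{Z}\oplus\mathbb{Z}/4\mathbb{Z}$ if and only if $K$ contains $\sqrt{-1}$ and there exists $\lambda\in K\setminus\{0,\pm1,\pm\sqrt{-1}\}$ such that $E$ is isomorphic (over $K$) to the elliptic curve $$\mathcal{E}_{2,\lambda}: y^2=\left(x+\frac{(\lambda^2-1)^2}{(\lambda^2+1)^2}\right)(x+1)x.$$ *)

(* Defs.v *)
From HB Require Import structures.
From mathcomp Require Import all_boot all_order all_algebra.
From mathcomp Require Import ring.

Set Implicit Arguments.
Unset Strict Implicit.
Unset Printing Implicit Defensive.

Import GRing.Theory.
Local Open Scope ring_scope.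

(* The coefficients of the general Weierstrass equation
     y^2 + a1 x y + a3 y = x^3 + a2 x^2 + a4 x + a6. *)
Record weierstrass (K : fieldType) := Weierstrass {
  wa1 : K; wa2 : K; wa3 : K; wa4 : K; wa6 : K }.

Definition disc (K : fieldType) (W : weierstrass K) : K :=
  let: Weierstrass a1 a2 a3 a4 a6 := W in
  let b2 := a1 ^+ 2 + 4%:R * a2 in
  let b4 := 2%:R * a4 + a1 * a3 in
  let b6 := a3 ^+ 2 + 4%:R * a6 in
  let b8 := a1 ^+ 2 * a6 + 4%:R * a2 * a6 - a1 * a3 * a4
            + a2 * a3 ^+ 2 - a4 ^+ 2 in
  - b2 ^+ 2 * b8 - 8%:R * b4 ^+ 3 - 27%:R * b6 ^+ 2 + 9%:R * b2 * b4 * b6.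

Record ellcurve (K : fieldType) := EllCurve {
  ec_weierstrass :> weierstrass K;
  ec_disc_neq0 : disc ec_weierstrass != 0 }.

Definition weq (K : fieldType) (W : weierstrass K) (x y : K) : K :=
  let: Weierstrass a1 a2 a3 a4 a6 := W in
  (y ^+ 2 + a1 * x * y + a3 * y) - (x ^+ 3 + a2 * x ^+ 2 + a4 * x + a6).

(* The admissible change of variables
     x = u^2 x' + r,   y = u^3 y' + u^2 s x' + t;
   see [weq_vchange]. *)
Definition vchange (K : fieldType) (u r s t : K) (W : weierstrass K) :
    weierstrass K :=
  let: Weierstrass a1 a2 a3 a4 a6 := W in
  Weierstrass
    ((a1 + 2%:R * s) / u)
    ((a2 - s * a1 + 3%:R * r - s ^+ 2) / u ^+ 2)
    ((a3 + r * a1 + 2%:R * t) / u ^+ 3)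
    ((a4 - s * a3 + 2%:R * r * a2 - (t + r * s) * a1 + 3%:R * r ^+ 2
       - 2%:R * s * t) / u ^+ 4)
    ((a6 + r * a4 + r ^+ 2 * a2 + r ^+ 3 - t * a3 - t ^+ 2 - r * t * a1)
       / u ^+ 6).

Lemma weq_vchange (K : fieldType) (u r s t : K) (W : weierstrass K) (x y : K) :
  u != 0 ->
  weq W (u ^+ 2 * x + r) (u ^+ 3 * y + u ^+ 2 * s * x + t)
  = u ^+ 6 * weq (vchange u r s t W) x y.
Proof. by case: W => a1 a2 a3 a4 a6 u0 /=; field. Qed.

(* Isomorphism over K fixing the point at infinity. *)
Definition w_iso (K : fieldType) (W W' : weierstrass K) : Prop :=
  exists u r s t : K, u != 0 /\ W' = vchange u r s t W.

(* [None] is the point at infinity, [Some (x, y)] an affine point. *)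
Definition on_curve (K : fieldType) (W : weierstrass K) (P : option (K * K)) :
    bool :=
  if P is Some (x, y) then weq W x y == 0 else true.

Definition point (K : fieldType) (W : weierstrass K) : Type :=
  {P : option (K * K) | on_curve W P}.

Definition opp_raw (K : fieldType) (W : weierstrass K) (P : option (K * K)) :
    option (K * K) :=
  if P is Some (x, y) then Some (x, - y - wa1 W * x - wa3 W) else None.

(* Third intersection of the curve with the line of slope l through (x1, y1)
   and a second point of abscissa x2, followed by negation. *)
Definition line_sum (K : fieldType) (W : weierstrass K) (l x1 y1 x2 : K) :
    option (K * K) :=
  let x3 := l ^+ 2 + wa1 W * l - wa2 W - x1 - x2 in
  opp_raw W (Some (x3, y1 + l * (x3 - x1))).

Definition add_raw (K : fieldType) (W : weierstrass K)
    (P Q : option (K * K)) : option (K * K) :=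
  match P, Q with
  | None, _ => Q
  | _, None => P
  | Some (x1, y1), Some (x2, y2) =>
      if x1 != x2 then line_sum W ((y2 - y1) / (x2 - x1)) x1 y1 x2
      else if y1 + y2 + wa1 W * x2 + wa3 W == 0 then None
      else line_sum W
             ((3%:R * x1 ^+ 2 + 2%:R * wa2 W * x1 + wa4 W - wa1 W * y1)
              / (2%:R * y1 + wa1 W * x1 + wa3 W)) x1 y1 x2
  end.

Lemma opp_rawP (K : fieldType) (W : weierstrass K) (P : option (K * K)) :
  on_curve W P -> on_curve W (opp_raw W P).
Proof.
case: P => [[x y]|] //; case: W => a1 a2 a3 a4 a6 /= /eqP e.
by apply/eqP; rewrite -e; ring.
Qed.

Lemma line_sumP (K : fieldType) (W : weierstrass K) (l x1 y1 x2 : K) :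
  weq W x1 y1 = 0 ->
  l * (y1 + l * (x2 - x1) + y1) + wa1 W * (l * x2 + y1) + wa3 W * l
    - (x2 ^+ 2 + x2 * x1 + x1 ^+ 2) - wa2 W * (x2 + x1) - wa4 W = 0 ->
  on_curve W (line_sum W l x1 y1 x2).
Proof.
move=> e d; apply: opp_rawP; move: e d.
case: W => a1 a2 a3 a4 a6; rewrite /on_curve /= => e d; apply/eqP.
set x3 := _ - x2.
transitivity ((y1 ^+ 2 + a1 * x1 * y1 + a3 * y1
    - (x1 ^+ 3 + a2 * x1 ^+ 2 + a4 * x1 + a6)) + (x3 - x1) *
  (l * (y1 + l * (x2 - x1) + y1) + a1 * (l * x2 + y1) + a3 * l
    - (x2 ^+ 2 + x2 * x1 + x1 ^+ 2) - a2 * (x2 + x1) - a4)).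
  by rewrite /x3; ring.
by rewrite e d mulr0 addr0.
Qed.

Lemma add_rawP (K : fieldType) (W : weierstrass K) (P Q : option (K * K)) :
  on_curve W P -> on_curve W Q -> on_curve W (add_raw W P Q).
Proof.
case: P Q => [[x1 y1]|] [[x2 y2]|] //= /eqP e1 /eqP e2.
case: eqVneq => [ex|nx] /=.
  case: eqVneq => [//|ny]; rewrite -{}ex in e2 ny *; apply: line_sumP => //.
  have dy : 2%:R * y1 + wa1 W * x1 + wa3 W != 0.
    apply: contra_neq ny => h.
    have : (y1 - y2) * (y1 + y2 + wa1 W * x1 + wa3 W) = 0.
      rewrite -[RHS](subrr 0) -{1}e1 -{1}e2.
      by case: (W) => a1 a2 a3 a4 a6 /=; ring.
    move/eqP; rewrite mulf_eq0 subr_eq0 => /orP[/eqP <-|/eqP //].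
    by rewrite -h; ring.
  by field.
apply: line_sumP => //; have nx' : x2 - x1 != 0 by rewrite subr_eq0 eq_sym.
apply: (mulfI nx'); rewrite mulr0 -[RHS](subrr 0) -{1}e2 -{1}e1.
by move: e1 e2 => _ _; case: W => a1 a2 a3 a4 a6 /=; field.
Qed.

Definition pt_zero (K : fieldType) (W : weierstrass K) : point W :=
  exist _ None isT.

Definition pt_opp (K : fieldType) (W : weierstrass K) (P : point W) : point W :=
  exist _ (opp_raw W (sval P)) (opp_rawP (svalP P)).

Definition pt_add (K : fieldType) (W : weierstrass K) (P Q : point W) :
    point W :=
  exist _ (add_raw W (sval P) (sval Q)) (add_rawP (svalP P) (svalP Q)).

Definition is_subgroup (K : fieldType) (W : weierstrass K)
    (H : point W -> Prop) : Prop :=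
  [/\ H (pt_zero W),
      forall P Q, H P -> H Q -> H (pt_add P Q) &
      forall P, H P -> H (pt_opp P)].

Definition has_subgroup_iso (K : fieldType) (W : weierstrass K)
    (G : zmodType) : Prop :=
  exists H : point W -> Prop, is_subgroup H /\
    exists f : G -> point W,
      [/\ injective f,
          forall P, H P <-> exists g, f g = P &
          forall g h, f (g + h) = pt_add (f g) (f h)].

(* y^2 = (x + c) (x + 1) x with c = (l^2 - 1)^2 / (l^2 + 1)^2;
   see [weq_E2] and [disc_E2]. *)
Definition E2_weierstrass (K : fieldType) (l : K) : weierstrass K :=
  let c := (l ^+ 2 - 1) ^+ 2 / (l ^+ 2 + 1) ^+ 2 in
  Weierstrass 0 (c + 1) 0 c 0.

Lemma weq_E2 (K : fieldType) (l x y : K) :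
  weq (E2_weierstrass l) x y =
  y ^+ 2 - (x + (l ^+ 2 - 1) ^+ 2 / (l ^+ 2 + 1) ^+ 2) * (x + 1) * x.
Proof. by rewrite /=; ring. Qed.

Lemma disc_E2 (K : fieldType) (l i : K) :
  2%N \notin [pchar K] -> i ^+ 2 = -1 ->
  l \notin [:: 0; 1; -1; i; - i] -> disc (E2_weierstrass l) != 0.
Proof.
move=> n2 i2; rewrite !inE !negb_or => /and5P[l0 l1 lN1 li lNi].
have two : 2%:R != 0 :> K by move: n2; rewrite inE.
have dp : l ^+ 2 + 1 != 0.
  rewrite -[1]opprK -i2 subr_sqr mulf_neq0 // ?subr_eq0 //.
  by rewrite addr_eq0.
have dm : l ^+ 2 - 1 != 0.
  by rewrite subr_sqr_1 mulf_neq0 // ?subr_eq0 // addr_eq0.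
have -> : disc (E2_weierstrass l) =
   (2%:R ^+ 2 * (2%:R * l) ^+ 2 * (l ^+ 2 - 1) ^+ 2 / (l ^+ 2 + 1) ^+ 4) ^+ 2.
  by rewrite /=; field.
by rewrite !(expf_neq0, mulf_neq0, invr_neq0).
Qed.

(* Main.v *)
(* Complete the square and write E as y^2 = (x - e1)(x - e2)(x - e3).  If
   (x, y) is any affine point and (x', y') its double, then
     x' - e1 = (((x - e1)^2 - (e1 - e2)(e1 - e3)) / (2 y))^2,
   so (e1, 0) is a double only if e1 - e2 and e1 - e3 are squares.  A subgroup
   (Z/4)^2 makes the three points (ej, 0) rational and doubles, so all the
   differences ej - ek are squares, and so is -1.  With u^2 = e1 - e2,
   v^2 = e1 - e3, w^2 = e2 - e3, sending e1 to 0 and scaling by v^2 turns the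
   other two roots into -1 and -(u/v)^2, where (u/v)^2 + (w/v)^2 = 1;
   l = (u + v) / w parametrizes this conic.  Conversely, given i, u, v, w, the
   four halves of (e1, 0) are (e1 + u v, u v (u + v)) for all choices of the
   signs of u and v, similarly for (e2, 0) and (e3, 0), and the addition table
   of the resulting 16 points is that of (Z/4)^2. *)
Require Import Defs.
From HB Require Import structures.
From mathcomp Require Import all_boot all_order all_algebra.
From mathcomp Require Import ring.

Set Implicit Arguments.
Unset Strict Implicit.
Unset Printing Implicit Defensive.

Import GRing.Theory.
Local Open Scope ring_scope.

(** * The chord-tangent law and additive maps into the points *)

Section GroupLaw.

Variables (K : fieldType) (W : weierstrass K).
Implicit Types P Q : option (K * K).

(** Subtracting the two equations of the curve gives [(y1 - y2) (y1 + y2 + a1 x + a3) = 0]. *)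
Lemma on_curve_same_x (x y1 y2 : K) :
  on_curve W (Some (x, y1)) -> on_curve W (Some (x, y2)) ->
  y1 + y2 + wa1 W * x + wa3 W != 0 -> y1 = y2.
Proof.
move=> /eqP e1 /eqP e2 ny; apply/eqP; rewrite -subr_eq0.
rewrite -(inj_eq (mulIf ny)) mul0r -[X in _ == X](subrr 0) -{1}e1 -e2.
by apply/eqP; case: (W) => a1 a2 a3 a4 a6 /=; ring.
Qed.

Lemma add_raw_eq_None P Q : add_raw W P Q = None -> Q = opp_raw W P.
Proof.
case: P Q => [[x1 y1]|] [[x2 y2]|] //=.
case: eqVneq => //= <-; case: eqVneq => //= e _; congr (Some (_, _)).
by apply/eqP; rewrite -subr_eq0 -e; apply/eqP; ring.
Qed.

(** This forces an additive map to send 0 to infinity. If doubling an affine point kept its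
    abscissa, the tangent formula would give [y = - y - a1 x - a3], the case in which the double is
    infinity. *)
Lemma add_raw_idem P : add_raw W P P = P -> P = None.
Proof.
case: P => [[x y]|] //=; rewrite eqxx /=; case: eqVneq => //= ny.
rewrite /line_sum /=; set x3 := _ - x; case=> ->.
rewrite subrr mulr0 addr0 => e; case/eqP: ny.
by rewrite -{1}e; ring.
Qed.

Lemma add_rawC P Q :
  on_curve W P -> on_curve W Q -> add_raw W P Q = add_raw W Q P.
Proof.
case: P Q => [[x1 y1]|] [[x2 y2]|] // cP cQ.
rewrite /add_raw eq_sym; case: eqVneq => [ex|nx] /=.
  rewrite ex in cQ *; rewrite (addrC y2); case: eqVneq => // ny.
  by rewrite (on_curve_same_x cP cQ ny).
rewrite /line_sum /=.
have n12 : x1 - x2 != 0 by rewrite subr_eq0 eq_sym.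
have n21 : x2 - x1 != 0 by rewrite subr_eq0.
by congr (Some (_, _)); field; rewrite n12.
Qed.

Lemma point_inj (P Q : point W) : sval P = sval Q -> P = Q.
Proof. exact: val_inj. Qed.

(** For an additive map, [f g + f (- g)] is infinity, so [f (- g)] is the opposite of [f g] and the
    image is a subgroup. If [f g = f h], then [f (g - h) = f (h - h)] is infinity, so a trivial
    kernel gives injectivity. *)
Lemma has_subgroup_isoP (G : zmodType) :
  has_subgroup_iso W G <->
  exists f : G -> option (K * K),
    [/\ forall g, on_curve W (f g), forall g, f g = None <-> g = 0 &
        forall g h, f (g + h) = add_raw W (f g) (f h)].
Proof.
split=> [[H [[H0 _ _] [f [f_inj Hf fD]]]]|[f [cf f0 fD]]].
  have f0 : sval (f 0) = None.
    by apply: add_raw_idem; rewrite -[in RHS](addr0 0) fD.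
  exists (fun g => sval (f g)); split=> [g|g|g h]; last by rewrite fD.
    exact: (svalP (f g)).
  by split=> [fg|-> //]; apply: f_inj; apply: point_inj; rewrite fg f0.
have f00 : f 0 = None by apply/f0.
pose F g : point W := exist _ (f g) (cf g).
have FD g h : F (g + h) = pt_add (F g) (F h) by apply/point_inj/fD.
have F0 : F 0 = pt_zero W by exact/point_inj.
have FN g : F (- g) = pt_opp (F g).
  by apply/point_inj/add_raw_eq_None; rewrite -fD subrr.
exists (fun P : point W => exists g, F g = P); split.
  split=> [|_ _ [g <-] [h <-]|_ [g <-]]; first by exists 0.
    by exists (g + h).
  by exists (- g).
exists F; split=> // g h Fgh; apply/eqP; rewrite -subr_eq0; apply/eqP/f0.
by rewrite fD -[f g]/(sval (F g)) Fgh -fD subrr.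
Qed.

End GroupLaw.

(** * Invariance under admissible changes of variables *)

Section ChangeOfVariables.

Variable K : fieldType.
Implicit Types W : weierstrass K.

Definition vchange_pt (u r s t : K) (P : option (K * K)) : option (K * K) :=
  if P is Some (x, y) then Some (u ^+ 2 * x + r, u ^+ 3 * y + u ^+ 2 * s * x + t)
  else None.

Lemma vchange_pt_on_curve u r s t W P : u != 0 ->
  on_curve (vchange u r s t W) P -> on_curve W (vchange_pt u r s t P).
Proof.
by case: P => [[x y]|] // u0 /eqP e; rewrite /= weq_vchange // e mulr0.
Qed.

(** The change of variables is affine and preserves vertical lines, so it maps lines to lines; a
    slope [l] becomes [(u^3 l + u^2 s) / u^2]. *)
Lemma vchange_pt_line_sum u r s t W l x1 y1 x2 : u != 0 ->
  vchange_pt u r s t (line_sum (vchange u r s t W) l x1 y1 x2) =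
  line_sum W (u * l + s) (u ^+ 2 * x1 + r) (u ^+ 3 * y1 + u ^+ 2 * s * x1 + t)
    (u ^+ 2 * x2 + r).
Proof.
by case: W => a1 a2 a3 a4 a6 u0; rewrite /line_sum /=; congr (Some (_, _)); field.
Qed.

Lemma vchange_pt_add u r s t W P Q : u != 0 ->
  let W' := vchange u r s t W in
  on_curve W' P -> on_curve W' Q ->
  vchange_pt u r s t (add_raw W' P Q) =
  add_raw W (vchange_pt u r s t P) (vchange_pt u r s t Q).
Proof.
move=> u0 W'; case: P Q => [[x1 y1]|] [[x2 y2]|] // cP cQ.
rewrite /add_raw 2![vchange_pt _ _ _ _ (Some _)]/=.
have -> : (u ^+ 2 * x1 + r != u ^+ 2 * x2 + r) = (x1 != x2).
  by rewrite (inj_eq (addIr r)) (inj_eq (mulfI (expf_neq0 2 u0))).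
case: (boolP (x1 != x2)) => [nx|/negPn/eqP ex]; cbv iota.
  rewrite /W' vchange_pt_line_sum //; congr line_sum.
  have nx' : x2 - x1 != 0 by rewrite subr_eq0 eq_sym.
  have -> : u ^+ 2 * x2 + r - (u ^+ 2 * x1 + r) = u ^+ 2 * (x2 - x1) by ring.
  by field; rewrite u0 nx'.
rewrite -{}ex in cQ *.
set n' := y1 + y2 + _ + _; set n := _ + _ + _ + wa3 W.
have en : n = u ^+ 3 * n'.
  by rewrite /n /n' /W'; clear -u0; case: W => a1 a2 a3 a4 a6 /=; field.
rewrite en mulf_eq0 (negPf (expf_neq0 3 u0)) orFb; case: eqVneq => // ny; cbv iota.
have ey := on_curve_same_x cP cQ ny; rewrite -{}ey in n n' en ny *.
rewrite {2}/W' vchange_pt_line_sum //; congr line_sum.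
have <- : n' = 2%:R * y1 + wa1 W' * x1 + wa3 W' by rewrite /n'; ring.
have -> : 2%:R * (u ^+ 3 * y1 + u ^+ 2 * s * x1 + t) +
  wa1 W * (u ^+ 2 * x1 + r) + wa3 W = u ^+ 3 * n' by rewrite -en /n; ring.
apply: (mulIf (mulf_neq0 (expf_neq0 3 u0) ny)).
rewrite [RHS]mulfVK ?mulf_neq0 ?expf_neq0 //.
(* [N] and [n'] are the numerator and denominator of the tangent slope on [W']; on [W] they become
   [u^4 N + s u^3 n'] and [u^3 n']. *)
set N := _ - _; transitivity (u ^+ 4 * N + s * (u ^+ 3 * n')).
  by field.
rewrite /N /n' /W'; clear -u0.
by case: W => a1 a2 a3 a4 a6 /=; field.
Qed.

Lemma w_iso_sym W W' : w_iso W W' -> w_iso W' W.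
Proof.
move=> [u [r [s [t [u0 ->]]]]].
(* Obtained by solving the substitution for the new coordinates. *)
exists u^-1, (- r / u ^+ 2), (- s / u), ((r * s - t) / u ^+ 3).
rewrite invr_eq0; split=> //; case: W => a1 a2 a3 a4 a6 /=.
by congr Weierstrass; field; rewrite u0 oner_eq0.
Qed.

Lemma w_iso_trans W W' W'' : w_iso W W' -> w_iso W' W'' -> w_iso W W''.
Proof.
move=> [u [r [s [t [u0 ->]]]]] [u' [r' [s' [t' [u0' ->]]]]].
exists (u * u'), (u ^+ 2 * r' + r), (u * s' + s).
exists (u ^+ 3 * t' + u ^+ 2 * s * r' + t).
rewrite mulf_neq0 //; split=> //; case: W => a1 a2 a3 a4 a6 /=.
by congr Weierstrass; field; rewrite u0 u0'.
Qed.

Lemma has_subgroup_iso_w_iso W W' (G : zmodType) :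
  w_iso W W' -> has_subgroup_iso W G -> has_subgroup_iso W' G.
Proof.
move=> /w_iso_sym[u [r [s [t [u0 ->]]]]] /has_subgroup_isoP[f [cf f0 fD]].
apply/has_subgroup_isoP; exists (fun g => vchange_pt u r s t (f g)).
split=> [g|g|g h]; first exact: vchange_pt_on_curve.
  by rewrite -f0; case: (f g) => [[]|].
by rewrite fD vchange_pt_add.
Qed.

End ChangeOfVariables.

(** * Curves with three rational roots and the halves of their 2-torsion points *)

Section FullTwoTorsion.

Variable K : fieldType.
Implicit Types (e u v w i : K).

Definition cubic e1 e2 e3 : weierstrass K :=
  Weierstrass 0 (- (e1 + e2 + e3)) 0 (e1 * e2 + e1 * e3 + e2 * e3)
    (- (e1 * e2 * e3)).

Lemma weq_cubic e1 e2 e3 x y :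
  weq (cubic e1 e2 e3) x y = y ^+ 2 - (x - e1) * (x - e2) * (x - e3).
Proof. by rewrite /=; ring. Qed.

Lemma cubicC e1 e2 e3 : cubic e1 e2 e3 = cubic e2 e1 e3.
Proof. by congr Weierstrass; ring. Qed.

Lemma cubicCA e1 e2 e3 : cubic e1 e2 e3 = cubic e2 e3 e1.
Proof. by congr Weierstrass; ring. Qed.

(** Taking the slope as a parameter, with its equation multiplied out, leaves polynomial identities
    to check once the slope is guessed. *)
Lemma add_raw_cubic_slope e1 e2 e3 l x1 y1 x2 y2 x3 y3 :
  x1 != x2 -> y2 - y1 = l * (x2 - x1) ->
  x3 = l ^+ 2 + (e1 + e2 + e3) - x1 - x2 -> y3 = - (y1 + l * (x3 - x1)) ->
  add_raw (cubic e1 e2 e3) (Some (x1, y1)) (Some (x2, y2)) = Some (x3, y3).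
Proof.
move=> nx dy -> ->; have nx' : x2 - x1 != 0 by rewrite subr_eq0 eq_sym.
rewrite /add_raw nx dy mulfK // /line_sum /=.
by congr (Some (_, _)); ring.
Qed.

Lemma add_raw_cubic_tangent e1 e2 e3 l x1 y1 x3 y3 :
  2%:R * y1 != 0 ->
  3%:R * x1 ^+ 2 - 2%:R * (e1 + e2 + e3) * x1 + (e1 * e2 + e1 * e3 + e2 * e3)
    = l * (2%:R * y1) ->
  x3 = l ^+ 2 + (e1 + e2 + e3) - x1 - x1 -> y3 = - (y1 + l * (x3 - x1)) ->
  add_raw (cubic e1 e2 e3) (Some (x1, y1)) (Some (x1, y1)) = Some (x3, y3).
Proof.
move=> ny dy -> ->; rewrite /add_raw eqxx /= !mul0r !addr0 subr0.
have -> : y1 + y1 = 2%:R * y1 by ring.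
rewrite (negPf ny) mulrN mulNr dy mulfK // /line_sum /=.
by congr (Some (_, _)); ring.
Qed.

Lemma add_raw_cubic_opp e1 e2 e3 x y :
  add_raw (cubic e1 e2 e3) (Some (x, y)) (Some (x, - y)) = None.
Proof. by rewrite /add_raw eqxx /= subrr mul0r !addr0 eqxx. Qed.

Lemma two_tors_double e1 e2 e3 e :
  add_raw (cubic e1 e2 e3) (Some (e, 0)) (Some (e, 0)) = None.
Proof. by rewrite /add_raw eqxx /= mul0r !addr0 eqxx. Qed.

(** The other two roots are reached by permuting the arguments of [cubic]. *)
Lemma add_raw_cubic_double e1 e2 e3 x y x' y' :
  on_curve (cubic e1 e2 e3) (Some (x, y)) ->
  add_raw (cubic e1 e2 e3) (Some (x, y)) (Some (x, y)) = Some (x', y') ->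
  exists u, u ^+ 2 = x' - e1.
Proof.
rewrite /on_curve weq_cubic subr_eq0 => /eqP e.
rewrite /add_raw eqxx /= !mul0r !addr0 subr0.
case: eqVneq => // ny [<- _].
have n2y : 2%:R * y != 0 by move: ny; rewrite mulr_natl mulr2n.
exists (((x - e1) ^+ 2 - (e1 - e2) * (e1 - e3)) / (2%:R * y)).
apply: (mulIf (expf_neq0 2 n2y)); rewrite -exprMn mulfVK //.
set N := 3%:R * _ + _ + _.
(* [N] is the numerator of the tangent slope. The first equality replaces [y^2] by the cubic; the
   second clears the denominator [2 y]. *)
transitivity (N ^+ 2 + (e1 + e2 + e3 - x - x - e1) * (4%:R * y ^+ 2)).
  by rewrite e /N; ring.
by field; move: n2y; rewrite mulf_eq0 negb_or andbC.
Qed.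

(* If [u ^+ 2 = e - e'] and [v ^+ 2 = e - e''], this is a half of the 2-torsion
   point [(e, 0)] on [cubic e e' e'']; flipping the signs of [u] and [v] yields
   the four halves. *)
Definition halfpt e u v : option (K * K) :=
  Some (e + u * v, u * v * (u + v)).

Lemma halfptC e u v : halfpt e u v = halfpt e v u.
Proof. by congr (Some (_, _)); ring. Qed.

(** At [x = e1 + u v] the three factors are [u v], [u (u + v)] and [v (u + v)], with product
    [(u v (u + v))^2]. *)
Lemma halfpt_on_curve e1 e2 e3 u v : u ^+ 2 = e1 - e2 -> v ^+ 2 = e1 - e3 ->
  on_curve (cubic e1 e2 e3) (halfpt e1 u v).
Proof.
move=> hu hv; rewrite /on_curve /halfpt weq_cubic.
have -> : e2 = e1 - u ^+ 2 by rewrite hu; ring.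
have -> : e3 = e1 - v ^+ 2 by rewrite hv; ring.
by apply/eqP; ring.
Qed.

Lemma sqrt_diff e1 e2 u : u ^+ 2 = e1 - e2 -> e2 = e1 - u ^+ 2.
Proof. by move=> ->; ring. Qed.

Lemma halfpt_opp e1 e2 e3 e u v :
  add_raw (cubic e1 e2 e3) (halfpt e u v) (halfpt e (- u) (- v)) = None.
Proof. by rewrite /halfpt mulrNN -opprD mulrN add_raw_cubic_opp. Qed.

Section Halves.

Variables (e1 e2 e3 u v : K).
Hypotheses (two : 2%:R != 0 :> K) (hu : u ^+ 2 = e1 - e2)
  (hv : v ^+ 2 = e1 - e3) (u0 : u != 0) (v0 : v != 0) (n23 : e2 != e3).
Local Notation W := (cubic e1 e2 e3).

(** [u + v] divides [v^2 - u^2 = e2 - e3]. *)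
Let uDv : u + v != 0.
Proof.
apply: contra_neq n23 => uv0; apply/eqP; rewrite -subr_eq0; apply/eqP.
transitivity ((v - u) * (u + v)); last by rewrite uv0 mulr0.
by rewrite (sqrt_diff hu) (sqrt_diff hv); ring.
Qed.


(** Dividing the ordinate [u v (u + v)] by [x - e1 = u v], [x - e2 = u (u + v)] and
    [x - e3 = v (u + v)] gives the slopes [u + v], [v] and [u] used here and in the next two
    lemmas. *)
Lemma two_tors_add_half1 :
  add_raw W (Some (e1, 0)) (halfpt e1 u v) = halfpt e1 (- u) (- v).
Proof.
have h2 := sqrt_diff hu; have h3 := sqrt_diff hv.
apply: (add_raw_cubic_slope (l := u + v)); rewrite ?h2 ?h3; try ring.
by rewrite -subr_eq0 opprD addrA subrr sub0r oppr_eq0 mulf_neq0.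
Qed.

Lemma two_tors_add_half2 :
  add_raw W (Some (e2, 0)) (halfpt e1 u v) = halfpt e1 u (- v).
Proof.
have h2 := sqrt_diff hu; have h3 := sqrt_diff hv.
apply: (add_raw_cubic_slope (l := v)); rewrite ?h2 ?h3; try ring.
rewrite -subr_eq0; have -> : e1 - u ^+ 2 - (e1 + u * v) = - (u * (u + v)) by ring.
by rewrite oppr_eq0 mulf_neq0.
Qed.

Lemma two_tors_add_half3 :
  add_raw W (Some (e3, 0)) (halfpt e1 u v) = halfpt e1 (- u) v.
Proof.
have h2 := sqrt_diff hu; have h3 := sqrt_diff hv.
apply: (add_raw_cubic_slope (l := u)); rewrite ?h2 ?h3; try ring.
rewrite -subr_eq0; have -> : e1 - v ^+ 2 - (e1 + u * v) = - (v * (u + v)) by ring.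
by rewrite oppr_eq0 mulf_neq0.
Qed.

(** The line joining [(e1, 0)] to the half is tangent there, since its third intersection is the
    half itself; hence again the slope [u + v]. The next two lemmas likewise reuse the lines through
    [(e3, 0)] and [(e2, 0)]. *)
Lemma halfpt_double : add_raw W (halfpt e1 u v) (halfpt e1 u v) = Some (e1, 0).
Proof.
have h2 := sqrt_diff hu; have h3 := sqrt_diff hv.
apply: (add_raw_cubic_tangent (l := u + v)); rewrite ?h2 ?h3; try ring.
by rewrite !mulf_neq0.
Qed.

Lemma halfpt_add_half3 :
  add_raw W (halfpt e1 u v) (halfpt e1 u (- v)) = Some (e3, 0).
Proof.
have h2 := sqrt_diff hu; have h3 := sqrt_diff hv.
apply: (add_raw_cubic_slope (l := u)); rewrite ?h2 ?h3; try ring.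
rewrite -subr_eq0; have -> : e1 + u * v - (e1 + u * - v) = 2%:R * (u * v) by ring.
by rewrite !mulf_neq0.
Qed.

Lemma halfpt_add_half2 :
  add_raw W (halfpt e1 u v) (halfpt e1 (- u) v) = Some (e2, 0).
Proof.
have h2 := sqrt_diff hu; have h3 := sqrt_diff hv.
apply: (add_raw_cubic_slope (l := v)); rewrite ?h2 ?h3; try ring.
rewrite -subr_eq0; have -> : e1 + u * v - (e1 + - u * v) = 2%:R * (u * v) by ring.
by rewrite !mulf_neq0.
Qed.

Lemma halfpt_add_mixed c d a' b' : c ^+ 2 = e2 - e1 -> d ^+ 2 = e2 - e3 ->
  a' * u = c * v -> b' * u = - (c * d) ->
  add_raw W (halfpt e1 u v) (halfpt e2 c d) = halfpt e3 a' b'.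
Proof.
move=> hc hd ea eb; have h2 := sqrt_diff hu; have h3 := sqrt_diff hv.
(* As [c^2 = - u^2], this quotient is a square root of -1, and the sum is the half of [(e3, 0)] with
   parameters [i v] and [- i d]. *)
pose i := c / u; have ec : c = i * u by rewrite mulfVK.
have hi : i ^+ 2 = -1.
  by rewrite /i expr_div_n hc hu -opprB mulNr divff // -hu expf_neq0.
have hd' : d ^+ 2 = v ^+ 2 - u ^+ 2 by rewrite hd h2 h3; ring.
have -> : a' = i * v by apply: (mulIf u0); rewrite ea ec; ring.
have -> : b' = - (i * d) by apply: (mulIf u0); rewrite eb ec; ring.
rewrite ec.
(* This is the chord slope after multiplying numerator and denominator by [u + v + i d] and reducing
   with [i^2 = -1] and [d^2 = v^2 - u^2]. *)
apply: (add_raw_cubic_slope (l := (1 + i) / 2%:R * (u - i * v + d))).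
- rewrite -subr_eq0 h2.
  have -> : e1 + u * v - (e1 - u ^+ 2 + i * u * d) = u * (u + v - i * d).
    by ring.
  rewrite mulf_neq0 //.
  suff : (u + v - i * d) * (u + v + i * d) != 0.
    by rewrite mulf_eq0 negb_or => /andP[].
  have -> : (u + v - i * d) * (u + v + i * d) = 2%:R * (v * (u + v)).
    by ring: hi hd'.
  by rewrite !mulf_neq0.
- by rewrite h2; field: hi hd'.
- by rewrite h2 h3; field: hi hd'.
- by rewrite h3; field: hi hd'.
Qed.

End Halves.

Lemma two_tors_add e1 e2 e3 : e1 != e2 ->
  add_raw (cubic e1 e2 e3) (Some (e1, 0)) (Some (e2, 0)) = Some (e3, 0).
Proof. by move=> n12; apply: (add_raw_cubic_slope (l := 0)); rewrite //; ring. Qed.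

End FullTwoTorsion.

(** * The sixteen points and their addition table *)

Section FourTorsion.

Variables (K : fieldType) (e1 e2 e3 i u v w : K).
Hypotheses (two : 2%:R != 0 :> K) (i2 : i ^+ 2 = -1).
Hypotheses (hu : u ^+ 2 = e1 - e2) (hv : v ^+ 2 = e1 - e3)
  (hw : w ^+ 2 = e2 - e3).
Hypotheses (u0 : u != 0) (v0 : v != 0) (w0 : w != 0).
Local Notation W := (cubic e1 e2 e3).

(* The point [m P + n Q], where [P = halfpt e1 u v] and
   [Q = halfpt e2 (i * u) w], so that [2 P = (e1, 0)] and [2 Q = (e2, 0)]. *)
Definition four_torsion_nat (m n : nat) : option (K * K) :=
  nth None (nth [::]
    [:: [:: None; halfpt e2 (i * u) w;
            Some (e2, 0); halfpt e2 (- (i * u)) (- w)];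
        [:: halfpt e1 u v; halfpt e3 (i * v) (- (i * w));
            halfpt e1 u (- v); halfpt e3 (- (i * v)) (- (i * w))];
        [:: Some (e1, 0); halfpt e2 (i * u) (- w);
            Some (e3, 0); halfpt e2 (- (i * u)) w];
        [:: halfpt e1 (- u) (- v); halfpt e3 (i * v) (i * w);
            halfpt e1 (- u) v; halfpt e3 (- (i * v)) (i * w)]] m) n.

Let n12 : e1 != e2. Proof. by rewrite -subr_eq0 -hu expf_neq0. Qed.
Let n13 : e1 != e3. Proof. by rewrite -subr_eq0 -hv expf_neq0. Qed.
Let n23 : e2 != e3. Proof. by rewrite -subr_eq0 -hw expf_neq0. Qed.

Let W2 : W = cubic e2 e1 e3. Proof. exact: cubicC. Qed.
Let W3 : W = cubic e3 e1 e2. Proof. by rewrite 2!cubicCA. Qed.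
Let W13 : W = cubic e1 e3 e2. Proof. by rewrite W3 cubicC. Qed.
Let W23 : W = cubic e2 e3 e1. Proof. exact: cubicCA. Qed.

Lemma four_torsion_nat_on_curve m n :
  (m < 4)%N -> (n < 4)%N -> on_curve W (four_torsion_nat m n).
Proof.
have hiu : (i * u) ^+ 2 = e2 - e1 by rewrite exprMn i2 hu mulN1r opprB.
have hiv : (i * v) ^+ 2 = e3 - e1 by rewrite exprMn i2 hv mulN1r opprB.
have hiw : (i * w) ^+ 2 = e3 - e2 by rewrite exprMn i2 hw mulN1r opprB.
have c1 a b : a ^+ 2 = e1 - e2 -> b ^+ 2 = e1 - e3 -> on_curve W (halfpt e1 a b).
  exact: halfpt_on_curve.
have c2 a b : a ^+ 2 = e2 - e1 -> b ^+ 2 = e2 - e3 -> on_curve W (halfpt e2 a b).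
  by rewrite W2; exact: halfpt_on_curve.
have c3 a b : a ^+ 2 = e3 - e1 -> b ^+ 2 = e3 - e2 -> on_curve W (halfpt e3 a b).
  by rewrite W3; exact: halfpt_on_curve.
have t x : (x - e1) * (x - e2) * (x - e3) = 0 -> on_curve W (Some (x, 0)).
  by move=> e; rewrite /on_curve weq_cubic e expr0n subrr.
move: m n => [|[|[|[|//]]]] [|[|[|[|//]]]] _ _; cbn [nth four_torsion_nat].
all: by first [done | apply: c1; rewrite ?sqrrN | apply: c2; rewrite ?sqrrN
              | apply: c3; rewrite ?sqrrN | apply: t; ring].
Qed.

(** The indices modulo 4 match addition of representatives in ['Z_4], so this is the additivity of
    the map on ['Z_4 * 'Z_4]. *)
Lemma four_torsion_nat_add m n p q :
    (m < 4)%N -> (n < 4)%N -> (p < 4)%N -> (q < 4)%N ->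
  four_torsion_nat ((m + p) %% 4)%N ((n + q) %% 4)%N =
  add_raw W (four_torsion_nat m n) (four_torsion_nat p q).
Proof.
have hiu : (i * u) ^+ 2 = e2 - e1 by rewrite exprMn i2 hu mulN1r opprB.
have hiv : (i * v) ^+ 2 = e3 - e1 by rewrite exprMn i2 hv mulN1r opprB.
have hiw : (i * w) ^+ 2 = e3 - e2 by rewrite exprMn i2 hw mulN1r opprB.
have nz (a x : K) : a ^+ 2 = x -> x != 0 -> a != 0.
  by move=> <-; apply: contra_neq => ->; rewrite expr0n.
have n21 : e2 != e1 by rewrite eq_sym.
have n31 : e3 != e1 by rewrite eq_sym.
have n32 : e3 != e2 by rewrite eq_sym.
have dn x y : x != y -> x - y != 0 by rewrite subr_eq0.
have opp0 e a b a' b' : a' = - a -> b' = - b ->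
  add_raw W (halfpt e a b) (halfpt e a' b') = None.
  by move=> -> ->; exact: halfpt_opp.
have t0 e : add_raw W (Some (e, 0)) (Some (e, 0)) = None.
  exact: two_tors_double.
have t12 : add_raw W (Some (e1, 0)) (Some (e2, 0)) = Some (e3, 0).
  exact: two_tors_add.
have t13 : add_raw W (Some (e1, 0)) (Some (e3, 0)) = Some (e2, 0).
  by rewrite W13; exact: two_tors_add.
have t23 : add_raw W (Some (e2, 0)) (Some (e3, 0)) = Some (e1, 0).
  by rewrite W23; exact: two_tors_add.
(* The rules for halves under any ordering of the roots. Resulting signs are separate equations, so
   a rule unifies with a table entry before its signs are checked. *)
have gen e e' e'' : W = cubic e e' e'' -> e != e' -> e != e'' -> e' != e'' ->
  [/\ forall a b a' b', a ^+ 2 = e - e' -> b ^+ 2 = e - e'' ->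
        a' = - a -> b' = - b ->
        add_raw W (Some (e, 0)) (halfpt e a b) = halfpt e a' b',
      forall a b a' b', a ^+ 2 = e - e' -> b ^+ 2 = e - e'' ->
        a' = a -> b' = - b ->
        add_raw W (Some (e', 0)) (halfpt e a b) = halfpt e a' b',
      forall a b a' b', a ^+ 2 = e - e' -> b ^+ 2 = e - e'' ->
        a' = - a -> b' = b ->
        add_raw W (Some (e'', 0)) (halfpt e a b) = halfpt e a' b' &
  [/\ forall a b, a ^+ 2 = e - e' -> b ^+ 2 = e - e'' ->
        add_raw W (halfpt e a b) (halfpt e a b) = Some (e, 0),
      forall a b b', a ^+ 2 = e - e' -> b ^+ 2 = e - e'' -> b' = - b ->
        add_raw W (halfpt e a b) (halfpt e a b') = Some (e'', 0),
      forall a b a', a ^+ 2 = e - e' -> b ^+ 2 = e - e'' -> a' = - a ->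
        add_raw W (halfpt e a b) (halfpt e a' b) = Some (e', 0) &
      forall a b c d a' b', a ^+ 2 = e - e' -> b ^+ 2 = e - e'' ->
        c ^+ 2 = e' - e -> d ^+ 2 = e' - e'' ->
        a' * a = c * b -> b' * a = - (c * d) ->
        add_raw W (halfpt e a b) (halfpt e' c d) = halfpt e'' a' b']].
  move=> -> /dn n1 /dn n2 n3.
  do 2?split; move=> a b; move=> *; subst;
    (have a0 : a != 0 by apply: nz; eassumption);
    (have b0 : b != 0 by apply: nz; eassumption).
  - exact: two_tors_add_half1.
  - exact: two_tors_add_half2.
  - exact: two_tors_add_half3.
  - exact: halfpt_double.
  - exact: halfpt_add_half3.
  - exact: halfpt_add_half2.
  - apply: halfpt_add_mixed => //.
have [g11 g12 g13 [d1 s12 s13 m12]] := gen e1 e2 e3 erefl n12 n13 n23.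
have [g21 g22 g23 [d2 s21 s23 _]] := gen e2 e1 e3 W2 n21 n23 n13.
have [g31 g32 g33 [d3 s31 s32 _]] := gen e3 e1 e2 W3 n31 n32 n12.
have m13 a b c d a' b' : a ^+ 2 = e1 - e2 -> b ^+ 2 = e1 - e3 ->
    c ^+ 2 = e3 - e1 -> d ^+ 2 = e3 - e2 ->
    a' * b = c * a -> b' * b = - (c * d) ->
  add_raw W (halfpt e1 a b) (halfpt e3 c d) = halfpt e2 a' b'.
  move=> ha hb; rewrite halfptC.
  by case: (gen e1 e3 e2 W13 n13 n12 n32) => _ _ _ [_ _ _]; apply.
have m23 a b c d a' b' : a ^+ 2 = e2 - e1 -> b ^+ 2 = e2 - e3 ->
    c ^+ 2 = e3 - e1 -> d ^+ 2 = e3 - e2 ->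
    a' * b = d * a -> b' * b = - (d * c) ->
  add_raw W (halfpt e2 a b) (halfpt e3 c d) = halfpt e1 a' b'.
  move=> ha hb hc hd ea eb; rewrite halfptC [X in add_raw _ _ X]halfptC.
  by case: (gen e2 e3 e1 W23 n23 n21 n31) => _ _ _ [_ _ _]; apply.
have onW := four_torsion_nat_on_curve.
have huN : (- u) ^+ 2 = e1 - e2 by rewrite sqrrN.
have hvN : (- v) ^+ 2 = e1 - e3 by rewrite sqrrN.
have hwN : (- w) ^+ 2 = e2 - e3 by rewrite sqrrN.
have hiuN : (- (i * u)) ^+ 2 = e2 - e1 by rewrite sqrrN.
have hivN : (- (i * v)) ^+ 2 = e3 - e1 by rewrite sqrrN.
have hiwN : (- (i * w)) ^+ 2 = e3 - e2 by rewrite sqrrN.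
have addC : forall P Q, on_curve W P -> on_curve W Q ->
    add_raw W P Q = add_raw W Q P.
  by move=> P Q; exact: add_rawC.
have add0P P : add_raw W None P = P by [].
have addP0 P : add_raw W P None = P by case: P => [[]|].
move=> m4 n4 p4 q4; have := onW _ _ p4 q4; have := onW _ _ m4 n4.
clear gen onW; rewrite /four_torsion_nat.
(* Abstracting the operations keeps unification from unfolding them in the
   256 cases. *)
move: (on_curve W) addC => onW addC.
move: (add_raw W) (@halfpt K) add0P addP0 addC t0 t12 t13 t23 opp0
  g11 g12 g13 d1 s12 s13 g21 g22 g23 d2 s21 s23 g31 g32 g33 d3 s31 s32
  m12 m13 m23 => A h.
move=> add0P addP0 addC t0 t12 t13 t23 opp0
  g11 g12 g13 d1 s12 s13 g21 g22 g23 d2 s21 s23 g31 g32 g33 d3 s31 s32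
  m12 m13 m23.
move: m n p q m4 n4 p4 q4 =>
  [|[|[|[|//]]]] [|[|[|[|//]]]] [|[|[|[|//]]]] [|[|[|[|//]]]] _ _ _ _ /= cP cQ;
  rewrite ?add0P ?addP0 ?t0 // ?(d1, d2, d3) //;
  try by rewrite opp0 ?opprK.
all: try by (rewrite (t12, t13, t23) || rewrite addC // (t12, t13, t23)).
(* The roots occurring in a sum select the rule; its side conditions are the known squares or sign
   identities following from [i^2 = -1]. Sums in the opposite order are first commuted. *)
all: symmetry; let sum_rule := (idtac; first
  [ apply: m12 | apply: m13 | apply: m23
  | apply: g11 | apply: g12 | apply: g13
  | apply: g21 | apply: g22 | apply: g23
  | apply: g31 | apply: g32 | apply: g33
  | apply: s12 | apply: s13 | apply: s21 | apply: s23 | apply: s31 | apply: s32];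
  first [done | by rewrite ?opprK | by ring: i2]) in
  first [sum_rule | rewrite addC //; sum_rule].
Qed.

Lemma four_torsion_nat_eq_None m n : (m < 4)%N -> (n < 4)%N ->
  four_torsion_nat m n = None -> m = 0%N /\ n = 0%N.
Proof. by move: m n => [|[|[|[|//]]]] [|[|[|[|//]]]]. Qed.

Lemma has_subgroup_iso_cubic : has_subgroup_iso W ('Z_4 * 'Z_4)%type.
Proof.
apply/has_subgroup_isoP; exists (fun g : 'Z_4 * 'Z_4 => four_torsion_nat g.1 g.2).
split=> [[x y]|[x y]|[x y] [x' y']] /=.
- exact: four_torsion_nat_on_curve.
- split=> [|[-> ->] //]; case/four_torsion_nat_eq_None => // x0 y0.
  by congr (_, _); apply: val_inj.
- exact: four_torsion_nat_add.
Qed.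

End FourTorsion.

(** * From full 4-torsion to the parameter and back *)

Section FullFourTorsion.

Variable K : fieldType.
Hypothesis two : 2%:R != 0 :> K.

Lemma w_iso_complete_square (W : weierstrass K) :
  exists a2 a4 a6, w_iso W (Weierstrass 0 a2 0 a4 a6).
Proof.
case: W => a1 a2 a3 a4 a6.
pose s := - a1 / 2%:R; pose t := - a3 / 2%:R.
exists (a2 - s * a1 - s ^+ 2), (a4 - s * a3 - t * a1 - 2%:R * s * t).
exists (a6 - t * a3 - t ^+ 2), 1, 0, s, t; rewrite oner_neq0; split=> //=.
by congr Weierstrass; rewrite /s /t; field; rewrite ?oner_neq0.
Qed.

Lemma two_torsion_y0 (a2 a4 a6 : K) (P : option (K * K)) :
  P <> None -> add_raw (Weierstrass 0 a2 0 a4 a6) P P = None ->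
  exists x, P = Some (x, 0).
Proof.
case: P => [[x y] _|//] /add_raw_eq_None /= [ey]; exists x.
congr (Some (_, _)); apply: (mulfI two); rewrite mulr0 mulr_natl mulr2n {1}ey.
by ring.
Qed.

(** Divided differences: [q12] and [q13] are the first ones, [ha2] the second, and they yield [a2],
    then [a4], then [a6]. *)
Lemma cubic_of_roots (a2 a4 a6 e1 e2 e3 : K) :
  let W := Weierstrass 0 a2 0 a4 a6 in
  e1 != e2 -> e1 != e3 -> e2 != e3 -> on_curve W (Some (e1, 0)) ->
  on_curve W (Some (e2, 0)) -> on_curve W (Some (e3, 0)) ->
  W = cubic e1 e2 e3.
Proof.
rewrite /on_curve /= => n12 n13 n23 /eqP h1 /eqP h2 /eqP h3.
have dn (x y z : K) : x != y -> (x - y) * z = 0 -> z = 0.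
  by rewrite -subr_eq0 => nxy /eqP; rewrite mulf_eq0 (negPf nxy) => /eqP.
have q12 : e1 ^+ 2 + e1 * e2 + e2 ^+ 2 + a2 * (e1 + e2) + a4 = 0.
  apply: (dn _ _ _ n12); rewrite -[RHS](subrr 0).
  by rewrite -[X in _ = X - _]h2 -[X in _ = _ - X]h1; ring.
have q13 : e1 ^+ 2 + e1 * e3 + e3 ^+ 2 + a2 * (e1 + e3) + a4 = 0.
  apply: (dn _ _ _ n13); rewrite -[RHS](subrr 0).
  by rewrite -[X in _ = X - _]h3 -[X in _ = _ - X]h1; ring.
have ha2 : e1 + e2 + e3 + a2 = 0.
  apply: (dn _ _ _ n23); rewrite -[RHS](subrr 0).
  by rewrite -[X in _ = X - _]q12 -[X in _ = _ - X]q13; ring.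
have ea2 : a2 = - (e1 + e2 + e3).
  by apply/eqP; rewrite -addr_eq0 addrC ha2.
have ea4 : a4 = e1 * e2 + e1 * e3 + e2 * e3.
  by apply/eqP; rewrite -subr_eq0 -q12 ea2; apply/eqP; ring.
congr Weierstrass => //; apply/eqP; rewrite -subr_eq0 -oppr_eq0 -h1 ea2 ea4.
by apply/eqP; ring.
Qed.

Lemma w_iso_cubic_E2 (e1 e2 e3 i u v w : K) : i ^+ 2 = -1 ->
  u ^+ 2 = e1 - e2 -> v ^+ 2 = e1 - e3 -> w ^+ 2 = e2 - e3 ->
  u != 0 -> v != 0 -> w != 0 ->
  exists l, l \notin [:: 0; 1; -1; i; - i] /\
    w_iso (cubic e1 e2 e3) (E2_weierstrass l).
Proof.
move=> i2 hu hv hw u0 v0 w0.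
have h2 := sqrt_diff hu; have h3 := sqrt_diff hv.
have hw' : w ^+ 2 = v ^+ 2 - u ^+ 2 by rewrite hw h2 h3; ring.
have : (v - u) * (v + u) != 0 by rewrite -subr_sqr -hw' expf_neq0.
rewrite mulf_eq0 negb_or => /andP[vBu vDu].
(* Then [l^2 = (v + u) / (v - u)], so that [(l^2 - 1) / (l^2 + 1) = u / v]; [l] avoids 1, -1 and the
   roots of -1 because [u] and [v] are nonzero. *)
pose l := (v + u) / w.
have l2 : l ^+ 2 = (v + u) / (v - u).
  by rewrite /l expr_div_n hw' subr_sqr; field; rewrite vBu vDu.
have l2m : l ^+ 2 - 1 = 2%:R * u / (v - u) by rewrite l2; field.
have l2p : l ^+ 2 + 1 = 2%:R * v / (v - u) by rewrite l2; field.
exists l; split.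
  have l2p0 : l ^+ 2 + 1 != 0 by rewrite l2p !mulf_neq0 ?invr_neq0.
  have l2m0 : l ^+ 2 - 1 != 0 by rewrite l2m !mulf_neq0 ?invr_neq0.
  rewrite !inE !negb_or; apply/and5P; split.
  - by rewrite mulf_neq0 ?invr_neq0.
  - by apply: contra_neq l2m0 => ->; ring.
  - by apply: contra_neq l2m0 => ->; ring.
  - by apply: contra_neq l2p0 => ->; rewrite i2; ring.
  - by apply: contra_neq l2p0 => ->; rewrite sqrrN i2; ring.
exists v, e1, 0, 0; split=> //; rewrite /E2_weierstrass l2m l2p h2 h3 /=.
by congr Weierstrass; field; rewrite ?v0 ?vBu ?two.
Qed.

Lemma cubic_E2 (l : K) : E2_weierstrass l =
  cubic 0 (-1) (- ((l ^+ 2 - 1) ^+ 2 / (l ^+ 2 + 1) ^+ 2)).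
Proof. by congr Weierstrass; ring. Qed.

Lemma has_subgroup_iso_E2 (i l : K) : i ^+ 2 = -1 ->
  l \notin [:: 0; 1; -1; i; - i] ->
  has_subgroup_iso (E2_weierstrass l) ('Z_4 * 'Z_4)%type.
Proof.
move=> i2; rewrite !inE !negb_or => /and5P[l0 l1 lN1 li lNi].
have dp : l ^+ 2 + 1 != 0.
  rewrite -[1]opprK -i2 subr_sqr mulf_neq0 // ?subr_eq0 //.
  by rewrite addr_eq0.
have dm : l ^+ 2 - 1 != 0.
  by rewrite subr_sqr_1 mulf_neq0 // ?subr_eq0 // addr_eq0.
have i0 : i != 0.
  by apply: contra_eq_neq i2 => ->; rewrite expr0n eq_sym oppr_eq0 oner_eq0.
rewrite cubic_E2.
(* With roots 0, -1 and [- c] the differences are 1, [c] and [c - 1]; the last is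
   [- (2 l / (l^2 + 1))^2], whence the factor [i]. *)
apply: (@has_subgroup_iso_cubic _ _ _ _ i 1 ((l ^+ 2 - 1) / (l ^+ 2 + 1))
   (i * (2%:R * l / (l ^+ 2 + 1)))) => //.
- by ring.
- by rewrite expr_div_n; ring.
- by rewrite exprMn i2; field.
- exact: oner_neq0.
- by rewrite mulf_neq0 ?invr_neq0.
- by rewrite !mulf_neq0 ?invr_neq0.
Qed.

Lemma full_four_torsion_params (W : weierstrass K) :
  has_subgroup_iso W ('Z_4 * 'Z_4)%type ->
  exists e1 e2 e3 i u v w : K,
  [/\ w_iso W (cubic e1 e2 e3), i ^+ 2 = -1,
      [/\ u ^+ 2 = e1 - e2, v ^+ 2 = e1 - e3 & w ^+ 2 = e2 - e3]
    & [/\ u != 0, v != 0 & w != 0]].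
Proof.
have [a2 [a4 [a6]]] := w_iso_complete_square W.
set W' := Weierstrass _ _ _ _ _ => WW' /(has_subgroup_iso_w_iso WW').
move=> /has_subgroup_isoP[f [cf f0 fD]].
have tors (g : 'Z_4 * 'Z_4) : g <> 0 -> g + g = 0 ->
    exists x, f g = Some (x, 0).
  move=> g0 gg; apply: (@two_torsion_y0 a2 a4 a6); first by move/f0.
  by rewrite -fD gg; apply/f0.
pose P : 'Z_4 * 'Z_4 := (1, 0); pose Q : 'Z_4 * 'Z_4 := (0, 1).
have [e1 T1] : exists x, f (P + P) = Some (x, 0) by apply: tors; [|apply/eqP].
have [e2 T2] : exists x, f (Q + Q) = Some (x, 0) by apply: tors; [|apply/eqP].
have [e3 T3] : exists x, f (P + P + (Q + Q)) = Some (x, 0).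
  by apply: tors; [|apply/eqP].
(* Equal abscissas would give [f g = f h], so [f (g + h) = f (h + h)] would be infinity. *)
have f_neq (g h : 'Z_4 * 'Z_4) x y : f g = Some (x, 0) -> f h = Some (y, 0) ->
    g + h <> 0 -> h + h = 0 -> x != y.
  move=> fg fh gh hh; apply/eqP => xy; apply: gh; apply/f0.
  by rewrite fD fg xy -fh -fD hh; apply/f0.
have n12 : e1 != e2 by apply: (f_neq _ _ _ _ T1 T2) => //; apply/eqP.
have n13 : e1 != e3 by apply: (f_neq _ _ _ _ T1 T3) => //; apply/eqP.
have n23 : e2 != e3 by apply: (f_neq _ _ _ _ T2 T3) => //; apply/eqP.
have W'E : W' = cubic e1 e2 e3.
  by apply: cubic_of_roots => //; rewrite -?T1 -?T2 -?T3; apply: cf.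
have half g x e e' e'' : f (g + g) = Some (x, 0) -> W' = cubic e e' e'' ->
    exists u, u ^+ 2 = x - e.
  move=> fgg WE; move: (cf g) fgg; rewrite fD WE.
  case: (f g) => [[x' y']|//]; exact: add_raw_cubic_double.
have [u hu] := half P e1 e2 e1 e3 T1 (etrans W'E (cubicC _ _ _)).
have [v hv] := half P e1 e3 e1 e2 T1 (etrans W'E (esym (cubicCA _ _ _))).
have [u' hu'] := half Q e2 e1 e2 e3 T2 W'E.
have [w hw] := half Q e2 e3 e1 e2 T2 (etrans W'E (esym (cubicCA _ _ _))).
have nz (a x y : K) : a ^+ 2 = x - y -> x != y -> a != 0.
  move=> ha; rewrite -subr_eq0 -ha; apply: contra_neq => ->.
  by rewrite expr0n.
have u0 := nz _ _ _ hu n12.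
(* Halving [(e1, 0)] gives [u^2 = e1 - e2] and halving [(e2, 0)] gives [u'^2 = e2 - e1], so [u' / u]
   squares to -1. *)
exists e1, e2, e3, (u' / u), u, v, w; split=> //; first by rewrite -W'E.
  by rewrite expr_div_n hu' hu -opprB mulNr divff // subr_eq0.
by split=> //; [apply: nz hv n13 | apply: nz hw n23].
Qed.

End FullFourTorsion.

Theorem theorem5p8 (K : fieldType) (hK : 2%N \notin [pchar K])
    (E : ellcurve K) :
  has_subgroup_iso E ('Z_4 * 'Z_4)%type <->
  exists i : K, i ^+ 2 = -1 /\
    exists l : K, l \notin [:: 0; 1; -1; i; - i] /\
      w_iso E (E2_weierstrass l).
Proof.
have two : 2%:R != 0 :> K by move: hK; rewrite inE.
split=> [/(full_four_torsion_params two)|[i [i2 [l [hl iso]]]]].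
  move=> [e1 [e2 [e3 [i [u [v [w [iso i2 [hu hv hw] [u0 v0 w0]]]]]]]]].
  have [l [hl iso']] := w_iso_cubic_E2 two i2 hu hv hw u0 v0 w0.
  by exists i; split=> //; exists l; split=> //; exact: w_iso_trans iso iso'.
apply: (has_subgroup_iso_w_iso (w_iso_sym iso)).
exact: has_subgroup_iso_E2 two _ _ i2 hl.
Qed.
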